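(* Let $P\in\tilde{\mathcal{A}}$ be a monic polynomial in $a$ with coefficients in $\mathbb{C}[[b]]$, and define $E:=\tilde{\mathcal{A}}/\tilde{\mathcal{A}}P$. Let $v_1,\dots,v_l$ be the distinct eigenvalues of $a$ acting on $E/bE$, and let $d_1,\dots,d_l$ be the dimensions of the corresponding spectral (generalized eigen-) subspaces. Then there exist monic polynomials $P_1,\dots,P_l$, respectively in $a-v_1,\dots,a-v_l$, of respective degrees $d_1,\dots,d_l$, with coefficients in $\mathbb{C}[[b]]$, such that in $\tilde{\mathcal{A}}$ $$P=P_1\cdots P_l .$$
   Context: $\mathcal{A}=\mathbb{C}\langle a,b\rangle$ is the unital $\mathbb{C}$-algebra generated by $a,b$ with the relation $ab-ba=b^2$; $\tilde{\mathcal{A}}$ is its completion for the $b$-adic filtration given by the two-sided ideals $b^\nu\mathcal{A}$, $\nu\in\mathbb{N}$; it contains the commutative subalgebra $\mathbb{C}[[b]]$. The left $\tilde{\mathcal{A}}$-module $E$ is free of finite rank over $\mathbb{C}[[b]]$, $bE$ is stable under $a$, and $a$ acts $\mathbb{C}$-linearly on the finite-dimensional space $E/bE$. *)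

(* Defs.v *)
From HB Require Import structures.
From mathcomp Require Import all_boot all_order all_algebra.
From mathcomp Require Import boolp classical_sets functions reals.
From mathcomp Require Import complex.
From mathcomp.multinomials Require Import monalg.

Set Implicit Arguments.
Unset Strict Implicit.
Unset Printing Implicit Defensive.

Import GRing.Theory.
Local Open Scope ring_scope.
Local Open Scope quotient_scope.

(* The library's {quot I} is only a Z-module; here it is given the module
   structure of V/S. Membership in infinite objects is made boolean by asbool. *)
Section ModuleQuotient.
Variables (R : pzRingType) (V : lmodType R) (S : {pred V}).
Hypothesis HS : submod_closed S.

Definition lquot_closed : zmodClosed V :=
  HB.pack S (GRing.isZmodClosed.Build V S (GRing.submod_closedB HS)).

Definition lquot : Type := Quotient.quot lquot_closed.

HB.instance Definition _ := ZmodQuotient.on lquot.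

Lemma lquot_eq (x y : V) : (\pi_lquot x = \pi_lquot y) <-> (x - y \in S).
Proof.
have -> : (x - y \in S) = (x - y \in (lquot_closed : {pred V})) by [].
by rewrite Quotient.idealrBE; split => [H|/eqP //]; apply/eqP.
Qed.

Lemma lquot_piD (x y : V) : \pi_lquot (x + y) = \pi_lquot x + \pi_lquot y.
Proof. by rewrite !piE. Qed.

Definition lquot_scale (c : R) (x : lquot) : lquot := \pi_lquot (c *: repr x).

Lemma lquot_piZ (c : R) (x : V) : lquot_scale c (\pi_lquot x) = \pi_lquot (c *: x).
Proof.
apply/lquot_eq; rewrite -scalerBr -[_ *: _]addr0; case: HS => S0; apply=> //.
by apply/lquot_eq; rewrite reprK.
Qed.

Lemma lquot_scaleA a b v : lquot_scale a (lquot_scale b v) = lquot_scale (a * b) v.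
Proof. by elim/quotW: v => v; rewrite (lquot_piZ b) !lquot_piZ scalerA. Qed.

Lemma lquot_scale1 : left_id 1 lquot_scale.
Proof. by elim/quotW=> v; rewrite !lquot_piZ scale1r. Qed.

Lemma lquot_scaleDr : right_distributive lquot_scale +%R.
Proof.
move=> a; elim/quotW=> u; elim/quotW=> v.
by rewrite -lquot_piD !lquot_piZ scalerDr lquot_piD.
Qed.

Lemma lquot_scaleDl v : {morph lquot_scale^~ v : a b / a + b}.
Proof. by elim/quotW: v => v a b; rewrite !lquot_piZ scalerDl lquot_piD. Qed.

HB.instance Definition _ := GRing.Zmodule_isLmodule.Build R lquot
  lquot_scaleA lquot_scale1 lquot_scaleDr lquot_scaleDl.

Lemma lquot_piP (c : R) (x y : V) :
  \pi_lquot (c *: x + y) = c *: \pi_lquot x + \pi_lquot y.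
Proof. by rewrite lquot_piD -lquot_piZ. Qed.

End ModuleQuotient.

Section AlgebraQuotient.
Variables (K : comNzRingType) (A : algType K).

(* Proper two-sided ideals; properness is needed because lalgType requires
   1 != 0. *)
Record proper_ideal2 (I : {pred A}) : Prop := ProperIdeal2 {
  ideal2_0 : 0 \in I;
  ideal2_B : forall x y, x \in I -> y \in I -> x - y \in I;
  ideal2_Ml : forall u x, x \in I -> u * x \in I;
  ideal2_Mr : forall u x, x \in I -> x * u \in I;
  ideal2_1 : 1 \notin I
}.

Variables (I : {pred A}) (HI : proper_ideal2 I).

Lemma ideal2_submod : submod_closed I.
Proof.
split; first exact: (ideal2_0 HI).
move=> c u v uI vI; rewrite -[v]opprK -[- v]sub0r -mulr_algl.
apply: (ideal2_B HI); first exact: (ideal2_Ml HI).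
by apply: (ideal2_B HI) => //; apply: (ideal2_0 HI).
Qed.

Definition algquot : Type := lquot ideal2_submod.

HB.instance Definition _ := GRing.Lmodule.on algquot.
HB.instance Definition _ := ZmodQuotient.on algquot.

Lemma algquot_eq (x y : A) : (\pi_algquot x = \pi_algquot y) <-> (x - y \in I).
Proof. exact: lquot_eq. Qed.

Definition algquot_mul (x y : algquot) : algquot := \pi_algquot (repr x * repr y).

Lemma algquot_pi_mul x y :
  \pi_algquot (x * y) = algquot_mul (\pi_algquot x) (\pi_algquot y).
Proof.
apply/algquot_eq; set x' := repr _; set y' := repr _.
have -> : x * y - x' * y' = (x - x') * y - x' * (y' - y).
  by rewrite mulrBl mulrBr opprB addrA subrK.
apply: (ideal2_B HI); first (apply: (ideal2_Mr HI)); last apply: (ideal2_Ml HI).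
  by apply/algquot_eq; rewrite reprK.
by apply/algquot_eq; rewrite reprK.
Qed.

Lemma algquot_piD x y : \pi_algquot (x + y) = \pi_algquot x + \pi_algquot y.
Proof. exact: lquot_piD. Qed.

Lemma algquot_piB x y : \pi_algquot (x - y) = \pi_algquot x - \pi_algquot y.
Proof. by rewrite !piE. Qed.

Lemma algquot_piZ c x : \pi_algquot (c *: x) = c *: \pi_algquot x.
Proof. by rewrite -[RHS]/(lquot_scale _ _) lquot_piZ. Qed.

Lemma algquot_mulA : associative algquot_mul.
Proof.
elim/quotW=> x; elim/quotW=> y; elim/quotW=> z.
by rewrite -(algquot_pi_mul y z) -(algquot_pi_mul x y) -(algquot_pi_mul x)
  -(algquot_pi_mul _ z) mulrA.
Qed.
Lemma algquot_mul1l : left_id (\pi_algquot 1) algquot_mul.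
Proof. by elim/quotW=> x; rewrite -algquot_pi_mul mul1r. Qed.
Lemma algquot_mul1r : right_id (\pi_algquot 1) algquot_mul.
Proof. by elim/quotW=> x; rewrite -algquot_pi_mul mulr1. Qed.
Lemma algquot_mulDl : left_distributive algquot_mul +%R.
Proof.
elim/quotW=> x; elim/quotW=> y; elim/quotW=> z.
by rewrite -algquot_piD -!algquot_pi_mul -algquot_piD mulrDl.
Qed.
Lemma algquot_mulDr : right_distributive algquot_mul +%R.
Proof.
elim/quotW=> x; elim/quotW=> y; elim/quotW=> z.
by rewrite -algquot_piD -!algquot_pi_mul -algquot_piD mulrDr.
Qed.
Lemma algquot_1neq0 : \pi_algquot 1 != 0 :> algquot.
Proof.
have -> : 0 = \pi_algquot 0 :> algquot by rewrite !piE.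
by apply/eqP => /algquot_eq; rewrite subr0; apply/negP/(ideal2_1 HI).
Qed.

HB.instance Definition _ := GRing.Zmodule_isNzRing.Build algquot
  algquot_mulA algquot_mul1l algquot_mul1r algquot_mulDl algquot_mulDr
  algquot_1neq0.

Lemma algquot_piM x y : \pi_algquot (x * y) = \pi_algquot x * \pi_algquot y.
Proof. exact: algquot_pi_mul. Qed.

Lemma algquot_scalerAl (c : K) (x y : algquot) : c *: (x * y) = (c *: x) * y.
Proof.
elim/quotW: x => x; elim/quotW: y => y.
by rewrite -(algquot_piM x y) -!algquot_piZ -(algquot_piM (c *: x) y) scalerAl.
Qed.

HB.instance Definition _ := GRing.Lmodule_isLalgebra.Build K algquot
  algquot_scalerAl.

Lemma algquot_scalerAr (c : K) (x y : algquot) : c *: (x * y) = x * (c *: y).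
Proof.
elim/quotW: x => x; elim/quotW: y => y.
by rewrite -(algquot_piM x y) -!algquot_piZ -(algquot_piM x (c *: y)) scalerAr.
Qed.

HB.instance Definition _ := GRing.Lalgebra_isAlgebra.Build K algquot
  algquot_scalerAr.

End AlgebraQuotient.

Section ScalarRestriction.
Variables (K : comNzRingType) (A : algType K) (M : lmodType A).

Definition scalar_restr : Type := M.
HB.instance Definition _ := GRing.Zmodule.on scalar_restr.

Definition restr_scale (c : K) (x : scalar_restr) : scalar_restr :=
  c%:A *: (x : M).

Lemma restr_scaleA a b v : restr_scale a (restr_scale b v) = restr_scale (a * b) v.
Proof. by rewrite /restr_scale scalerA mulr_algl scalerA. Qed.

Lemma restr_scale1 : left_id 1 restr_scale.
Proof. by move=> v; rewrite /restr_scale !scale1r. Qed.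

Lemma restr_scaleDr : right_distributive restr_scale +%R.
Proof. by move=> c u v; apply: scalerDr. Qed.

Lemma restr_scaleDl v : {morph restr_scale^~ v : a b / a + b}.
Proof. by move=> c d; rewrite /restr_scale scalerDl; apply: scalerDl. Qed.

HB.instance Definition _ := GRing.Zmodule_isLmodule.Build K scalar_restr
  restr_scaleA restr_scale1 restr_scaleDr restr_scaleDl.

End ScalarRestriction.

Section LinearAlgebra.
Variables (K : fieldType) (V : lmodType K).

(* V need not come with a vectType structure, so dimensions are stated by
   exhibiting a basis. *)
Definition is_eigenvalue (f : V -> V) (v : K) : Prop :=
  exists2 x, x != 0 & f x = v *: x.

Definition spectral_space (f : V -> V) (v : K) (x : V) : Prop :=
  exists n, iter n (fun y => f y - v *: y) x = 0.

Definition has_dim (S : V -> Prop) (d : nat) : Prop :=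
  exists e : 'I_d -> V,
    (forall c : 'I_d -> K, \sum_(i < d) c i *: e i = 0 -> forall i, c i = 0) /\
    (forall x, S x <-> exists c : 'I_d -> K, x = \sum_(i < d) c i *: e i).

End LinearAlgebra.

Section GeneratedIdeal.
Variables (K : comNzRingType) (A : algType K) (r : A).

Definition ideal2_gen : {pred A} :=
  fun x => `[< exists s : seq (A * A), x = \sum_(u <- s) u.1 * r * u.2 >].

Lemma ideal2_gen_mem : r \in ideal2_gen.
Proof. by apply/asboolP; exists [:: (1, 1)]; rewrite big_seq1 mul1r mulr1. Qed.

Lemma ideal2_gen_proper : 1 \notin ideal2_gen -> proper_ideal2 ideal2_gen.
Proof.
split => //.
- by apply/asboolP; exists [::]; rewrite big_nil.
- move=> x y /asboolP[s ->] /asboolP[t ->]; apply/asboolP.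
  exists (s ++ [seq (- u.1, u.2) | u <- t]).
  rewrite big_cat big_map -sumrN; congr (_ + _); apply: eq_bigr => u _ /=.
  by rewrite !mulNr.
- move=> u x /asboolP[s ->]; apply/asboolP.
  exists [seq (u * v.1, v.2) | v <- s].
  by rewrite big_map mulr_sumr; apply: eq_bigr => v _; rewrite /= !mulrA.
- move=> u x /asboolP[s ->]; apply/asboolP.
  exists [seq (v.1, v.2 * u) | v <- s].
  by rewrite big_map mulr_suml; apply: eq_bigr => v _; rewrite /= !mulrA.
Qed.

End GeneratedIdeal.

Section JordanRelator.

Definition jordan_rel (R : pzRingType) (a b : R) : R :=
  a * b - b * a - b ^+ 2.

Lemma jordan_rel_morph (R S : pzRingType) (f : R -> S) (a b : R) :
  {morph f : x y / x - y} -> {morph f : x y / x * y} ->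
  f (jordan_rel a b) = jordan_rel (f a) (f b).
Proof. by move=> fB fM; rewrite /jordan_rel !expr2 !fB !fM. Qed.

Lemma jordan_commX (R : pzRingType) (a b : R) (n : nat) :
  a * b - b * a = b ^+ 2 -> a * b ^+ n = b ^+ n * (a + b *+ n).
Proof.
move=> ab; elim: n => [|n IH]; first by rewrite expr0 mul1r mulr1 mulr0n addr0.
have {}ab : a * b = b * a + b ^+ 2 by rewrite -ab addrC subrK.
rewrite exprSr mulrA IH -!mulrA; congr (_ * _).
by rewrite mulrDl ab mulrnAl !mulrDr mulrnAr -expr2 mulrSr -addrA (addrC (b ^+ 2)).
Qed.

End JordanRelator.

Section FreeAlgebra.
Variable K : comNzRingType.

(* The free algebra on two letters: a is the letter false, b the letter true. *)
Definition free2 : Type := {malg K[fmonom bool]}.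

HB.instance Definition _ := GRing.Lalgebra.on free2.

Lemma free2_mulC (c : K) (x : free2) : x * (malgC c : free2) = c *: x.
Proof.
rewrite malgM_def malgZ_def fgmulgU; apply/eq_bigr => k _.
by rewrite mulm1 mulrC.
Qed.

Lemma free2_scalerAr (c : K) (x y : free2) : c *: (x * y) = x * (c *: y).
Proof.
have -> : c *: y = (malgC c : free2) * y by rewrite -[LHS]mul_malgC.
by rewrite mulrA free2_mulC scalerAl.
Qed.

HB.instance Definition _ := GRing.Lalgebra_isAlgebra.Build K free2
  free2_scalerAr.

Definition free_a : free2 := mkmalgU (fmu false) 1.
Definition free_b : free2 := mkmalgU (fmu true) 1.

Lemma free2_ind (P : free2 -> Prop) :
  P 1 -> (forall x y, P x -> P y -> P (x + y)) ->
  (forall c x, P x -> P (c *: x)) ->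
  (forall x, P x -> P (free_a * x)) -> (forall x, P x -> P (free_b * x)) ->
  forall x, P x.
Proof.
move=> P1 PD PZ Pa Pb x; rewrite [x]monalgE.
apply: (big_ind P); [by rewrite -(scale0r 1); apply: PZ | exact: PD | move=> k _].
have -> : mkmalgU k x@_k = x@_k *: (mkmalgU k 1 : free2).
  by apply/malgP => l; rewrite mcoeffZ !mcoeffU mulrnAr mulr1.
apply: PZ; case: k => k; elim: k => [|g k IH].
  suff -> : mkmalgU (FMonom [::]) 1 = 1 :> free2 by [].
  by rewrite -fmoneE.
suff -> : mkmalgU (FMonom (g :: k)) 1
   = (mkmalgU (fmu g) 1 : free2) * mkmalgU (FMonom k) 1.
  by case: g; [apply: Pb | apply: Pa].
by rewrite malgM_def fgmulUU mulr1; congr mkmalgU; rewrite fmuE;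
  apply/eqP; rewrite fmP fmM.
Qed.

Definition rel_ideal : {pred free2} := ideal2_gen (jordan_rel free_a free_b).

Definition free_const (x : free2) : K :=
  mcoeff (mone : fmonom bool) (x : {malg K[fmonom bool]}).

Lemma free_const_B x y : free_const (x - y) = free_const x - free_const y.
Proof. exact: (mcoeffB (mone : fmonom bool) x y). Qed.

Lemma free_const_M x y : free_const (x * y) = free_const x * free_const y.
Proof. exact: (rmorphM (mcoeff (mone : fmonom bool) : {malg K[fmonom bool]} -> K)). Qed.

Lemma free_const_1 : free_const 1 = 1.
Proof. exact: (rmorph1 (mcoeff (mone : fmonom bool) : {malg K[fmonom bool]} -> K)). Qed.

Lemma free_const_0 : free_const 0 = 0.
Proof. exact: (mcoeff0 (mone : fmonom bool)). Qed.

Lemma free_const_gen i :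
  free_const (mkmalgU (fmu i) 1 : {malg K[fmonom bool]}) = 0.
Proof. by rewrite /free_const mcoeffU1 fmP fmU fm1. Qed.

Lemma free_const_sum (T : Type) (s : seq T) (F : T -> free2) :
  (forall i, free_const (F i) = 0) -> free_const (\sum_(i <- s) F i) = 0.
Proof.
move=> F0; elim/big_rec: _ => [|i x _ IH]; first exact: free_const_0.
have -> : F i + x = F i - (0 - x) by rewrite sub0r opprK.
by rewrite !free_const_B IH F0 free_const_0 !subr0.
Qed.

Lemma free_const_rel_ideal x : x \in rel_ideal -> free_const x = 0.
Proof.
move=> /asboolP[s ->]; apply: free_const_sum => u.
rewrite 2!free_const_M (jordan_rel_morph _ _ free_const_B free_const_M).
by rewrite /jordan_rel !free_const_gen expr2 !(mulr0, mul0r, subr0).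
Qed.

Lemma rel_ideal_proper : proper_ideal2 rel_ideal.
Proof.
apply: ideal2_gen_proper; apply/negP => /free_const_rel_ideal /eqP.
by rewrite free_const_1 oner_eq0.
Qed.

(* C<a,b> / (ab - ba - b^2) *)
Definition algA : Type := algquot rel_ideal_proper.
HB.instance Definition _ := GRing.Algebra.on algA.
HB.instance Definition _ := ZmodQuotient.on algA.

Definition gen_a : algA := \pi_algA free_a.
Definition gen_b : algA := \pi_algA free_b.

Lemma gen_ab : gen_a * gen_b - gen_b * gen_a = gen_b ^+ 2.
Proof.
apply/eqP; rewrite -subr_eq0 -[X in X == _]/(jordan_rel gen_a gen_b).
rewrite -(jordan_rel_morph (f := \pi_algA)); last 2 first.
- exact: algquot_piB.
- exact: algquot_piM.
have -> : 0 = \pi_algA 0 :> algA by rewrite !piE.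
apply/eqP/algquot_eq; rewrite subr0; exact: ideal2_gen_mem.
Qed.

(* The filtration b^n A; bidealMl and bidealMr show that it is two-sided. *)
Definition bideal (n : nat) : {pred algA} :=
  fun x => `[< exists y, x = gen_b ^+ n * y >].

Lemma bidealB n x y : x \in bideal n -> y \in bideal n -> x - y \in bideal n.
Proof.
move=> /asboolP[u ->] /asboolP[v ->]; apply/asboolP.
by exists (u - v); rewrite mulrBr.
Qed.

Lemma bideal0 n : 0 \in bideal n.
Proof. by apply/asboolP; exists 0; rewrite mulr0. Qed.

Lemma bidealD n x y : x \in bideal n -> y \in bideal n -> x + y \in bideal n.
Proof.
move=> xb yb; rewrite -[y]opprK -[- y]sub0r.
by apply: bidealB => //; apply: bidealB => //; apply: bideal0.
Qed.

Lemma bidealZ n c x : x \in bideal n -> c *: x \in bideal n.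
Proof. by move=> /asboolP[u ->]; apply/asboolP; exists (c *: u); rewrite scalerAr. Qed.

Lemma bidealMr n u x : x \in bideal n -> x * u \in bideal n.
Proof. by move=> /asboolP[v ->]; apply/asboolP; exists (v * u); rewrite mulrA. Qed.

Lemma gen_a_bX n : gen_a * gen_b ^+ n = gen_b ^+ n * (gen_a + gen_b *+ n).
Proof.
exact: jordan_commX gen_ab.
Qed.

Lemma algA_ind (P : algA -> Prop) :
  P 1 -> (forall x y, P x -> P y -> P (x + y)) ->
  (forall c x, P x -> P (c *: x)) ->
  (forall x, P x -> P (gen_a * x)) -> (forall x, P x -> P (gen_b * x)) ->
  forall x, P x.
Proof.
move=> P1 PD PZ Pa Pb; elim/quotW; apply: free2_ind => //.
- by move=> x y Px Py; apply: (eq_ind_r P (PD _ _ Px Py) (algquot_piD _ x y)).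
- by move=> c x Px; apply: (eq_ind_r P (PZ c _ Px) (algquot_piZ _ c x)).
- by move=> x Px; apply: (eq_ind_r P (Pa _ Px) (algquot_piM _ free_a x)).
- by move=> x Px; apply: (eq_ind_r P (Pb _ Px) (algquot_piM _ free_b x)).
Qed.

Lemma bidealMl n u x : x \in bideal n -> u * x \in bideal n.
Proof.
move=> /asboolP[y ->]; rewrite mulrA; apply: bidealMr.
elim/algA_ind: u => [|u v IHu IHv|c u IH|u IH|u IH].
- by apply/asboolP; exists 1; rewrite mulr1 mul1r.
- by rewrite (mulrDl u v); apply: bidealD.
- by rewrite -(scalerAl c u); apply: bidealZ.
- rewrite -(mulrA gen_a u); case/asboolP: IH => w ->; apply/asboolP.
  exists ((gen_a + gen_b *+ n) * w).
  by rewrite (mulrA gen_a) gen_a_bX -(mulrA (gen_b ^+ n)).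
- rewrite -(mulrA gen_b u); case/asboolP: IH => w ->; apply/asboolP.
  by exists (gen_b * w); rewrite !mulrA -exprS -exprSr.
Qed.

Lemma bideal1 : 1 \notin bideal 1.
Proof.
apply/negP => /asboolP[y]; elim/quotW: y => y.
rewrite expr1 -[1]/(\pi_algA 1) -algquot_piM => /algquot_eq.
move/free_const_rel_ideal/eqP; rewrite free_const_B free_const_M free_const_1.
by rewrite free_const_gen mul0r subr0 oner_eq0.
Qed.

Definition seqs : Type := nat -> algA.
HB.instance Definition _ := GRing.NzRing.on seqs.
HB.instance Definition _ := GRing.Lmodule.on seqs.

Lemma seqs_scalerAl (c : K) (x y : seqs) : c *: (x * y) = (c *: x) * y.
Proof. by apply/funext => i; apply: scalerAl. Qed.

HB.instance Definition _ := GRing.Lmodule_isLalgebra.Build K seqs seqs_scalerAl.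

Lemma seqs_scalerAr (c : K) (x y : seqs) : c *: (x * y) = x * (c *: y).
Proof. by apply/funext => i; apply: scalerAr. Qed.

HB.instance Definition _ := GRing.Lalgebra_isAlgebra.Build K seqs seqs_scalerAr.

Definition cauchy : {pred seqs} :=
  fun x => `[< forall n, exists N, forall i j,
                 (N <= i)%N -> (N <= j)%N -> x i - x j \in bideal n >].

Lemma cauchy_subalg : GRing.subalg_closed cauchy.
Proof.
split.
- by apply/asboolP => n; exists 0%N => i j _ _; rewrite subrr bideal0.
- move=> c x y /asboolP xC /asboolP yC; apply/asboolP => n.
  have [[N xN] [M yM]] := (xC n, yC n); exists (maxn N M) => i j.
  rewrite !geq_max => /andP[Ni Mi] /andP[Nj Mj].
  have -> : (c *: x + y) i - (c *: x + y) j = c *: (x i - x j) + (y i - y j).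
    by rewrite scalerBr addrACA -opprD.
  by apply: bidealD; [apply/bidealZ/xN | apply: yM].
- move=> x y /asboolP xC /asboolP yC; apply/asboolP => n.
  have [[N xN] [M yM]] := (xC n, yC n); exists (maxn N M) => i j.
  rewrite !geq_max => /andP[Ni Mi] /andP[Nj Mj].
  have -> : (x * y) i - (x * y) j = x i * (y i - y j) + (x i - x j) * y j.
    by rewrite mulrBr mulrBl addrA subrK.
  by apply: bidealD; [apply/bidealMl/yM | apply/bidealMr/xN].
Qed.

HB.instance Definition _ := GRing.isSubalgClosed.Build K seqs cauchy cauchy_subalg.

Record cauchy_seq := CauchySeq {
  cauchy_val :> seqs;
  cauchy_valP : cauchy_val \in cauchy
}.
HB.instance Definition _ := [isSub for cauchy_val].
HB.instance Definition _ := [Choice of cauchy_seq by <:].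
HB.instance Definition _ := [SubChoice_isSubAlgebra of cauchy_seq by <:].

Definition null_seq : {pred cauchy_seq} :=
  fun x => `[< forall n, exists N, forall i, (N <= i)%N -> cauchy_val x i \in bideal n >].

Lemma cauchy_valM (x y : cauchy_seq) i :
  cauchy_val (x * y) i = cauchy_val x i * cauchy_val y i.
Proof. by []. Qed.

Lemma null_seq_proper : proper_ideal2 null_seq.
Proof.
split.
- by apply/asboolP => n; exists 0%N => i _; apply: bideal0.
- move=> x y /asboolP xC /asboolP yC; apply/asboolP => n.
  have [[N xN] [M yM]] := (xC n, yC n); exists (maxn N M) => i.
  by rewrite geq_max => /andP[Ni Mi]; apply: bidealB; [apply: xN | apply: yM].
- move=> u x /asboolP xC; apply/asboolP => n.
  have [N xN] := xC n; exists N => i Ni.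
  by rewrite cauchy_valM; apply/bidealMl/xN.
- move=> u x /asboolP xC; apply/asboolP => n.
  have [N xN] := xC n; exists N => i Ni.
  by rewrite cauchy_valM; apply/bidealMr/xN.
- apply/negP => /asboolP /(_ 1%N)[N /(_ N (leqnn N))].
  exact/negP/bideal1.
Qed.

(* The completion of algA for the filtration (bideal n)_n: Cauchy sequences
   modulo null sequences. *)
Definition algAt : Type := algquot null_seq_proper.
HB.instance Definition _ := GRing.Algebra.on algAt.
HB.instance Definition _ := ZmodQuotient.on algAt.

Lemma const_cauchy (x : algA) : (fun=> x) \in cauchy.
Proof. by apply/asboolP => n; exists 0%N => i j _ _; rewrite subrr bideal0. Qed.

Definition to_algAt (x : algA) : algAt := \pi_algAt (CauchySeq (const_cauchy x)).

Definition at_a : algAt := to_algAt gen_a.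
Definition at_b : algAt := to_algAt gen_b.

Lemma to_algAtB : {morph to_algAt : x y / x - y}.
Proof.
by move=> x y; rewrite /to_algAt -algquot_piB; congr (\pi _); apply: val_inj.
Qed.

Lemma to_algAtM : {morph to_algAt : x y / x * y}.
Proof.
by move=> x y; rewrite /to_algAt -algquot_piM; congr (\pi _); apply: val_inj.
Qed.

Lemma at_ab : at_a * at_b - at_b * at_a = at_b ^+ 2.
Proof. by rewrite /at_a /at_b expr2 -!to_algAtM -to_algAtB gen_ab expr2. Qed.

Lemma bseries_cauchy (f : nat -> K) :
  (fun n => \sum_(j < n) f j *: gen_b ^+ j) \in cauchy.
Proof.
apply/asboolP => n; exists n => i j.
wlog le_ij : i j / (i <= j)%N => [hw|] ni nj.
  have [ij|/ltnW ji] := leqP i j; first exact: hw.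
  rewrite -[X in X \in _]opprB -[X in X \in _]sub0r.
  by apply: bidealB; [apply: bideal0 | apply: hw].
rewrite -[X in X \in _]opprB -[X in X \in _]sub0r; apply: bidealB.
  exact: bideal0.
elim: j le_ij nj => [|j IH]; first by rewrite leqn0 => /eqP-> _; rewrite subrr bideal0.
rewrite leq_eqVlt => /orP[/eqP <- _|ij _]; first by rewrite subrr bideal0.
rewrite big_ord_recr /= addrAC; apply: bidealD.
  by apply: IH => //; apply: leq_trans ni ij.
apply: bidealZ; apply/asboolP; exists (gen_b ^+ (j - n)).
by rewrite -exprD subnKC //; apply: leq_trans ni _.
Qed.

(* The element \sum_j f_j b^j of C[[b]], as the limit of its partial sums. *)
Definition bseries (f : nat -> K) : algAt :=
  \pi_algAt (CauchySeq (bseries_cauchy f)).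

(* Q is a monic polynomial of degree d in u, with coefficients in C[[b]]
   written on the left. For u = a - v the side is immaterial: the commutator
   of u with f(b) is b^2 f'(b). *)
Definition monic_in (u : algAt) (d : nat) (Q : algAt) : Prop :=
  exists c : 'I_d -> nat -> K,
    Q = u ^+ d + \sum_(i < d) bseries (c i) * u ^+ i.

Section QuotientModule.
Variable P : algAt.

Definition left_ideal : {pred algAt^o} := fun x => `[< exists u, x = u * P >].

Lemma left_ideal_submod : submod_closed left_ideal.
Proof.
split; first by apply/asboolP; exists 0; rewrite mul0r.
move=> u x y /asboolP[v ->] /asboolP[w ->]; apply/asboolP.
by exists (u * v + w); rewrite mulrDl -mulrA.
Qed.

(* E = At / At P as a left module over At *)
Definition modE : Type := lquot left_ideal_submod.
HB.instance Definition _ := GRing.Lmodule.on modE.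

HB.instance Definition _ := ZmodQuotient.on modE.

Definition modE_C : Type := scalar_restr modE.
HB.instance Definition _ := GRing.Lmodule.on modE_C.

Definition bE : {pred modE_C} :=
  fun x => `[< exists y : modE, x = at_b *: y >].

Lemma bE_submod : submod_closed bE.
Proof.
split; first by apply/asboolP; exists 0; rewrite scaler0.
move=> c x y /asboolP[x' ->] /asboolP[y' ->]; apply/asboolP.
exists (c%:A *: x' + y'); rewrite (scalerDr at_b) (scalerA at_b) mulr_algr.
by rewrite -mulr_algl -scalerA.
Qed.

Definition modE_b : Type := lquot bE_submod.
HB.instance Definition _ := GRing.Lmodule.on modE_b.

HB.instance Definition _ := ZmodQuotient.on modE_b.

Lemma bE_a_stable (x : modE) : x \in bE -> at_a *: x \in bE.
Proof.
move=> /asboolP[y ->]; apply/asboolP; exists ((at_a + at_b) *: y).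
have ab : at_a * at_b = at_b * (at_a + at_b).
  by rewrite mulrDr -expr2 -at_ab addrC subrK.
by rewrite !scalerA ab.
Qed.

(* The action of a on E/bE; it does not depend on the representative, see
   act_a_pi. *)
Definition act_a (x : modE_b) : modE_b :=
  \pi_modE_b (at_a *: (repr x : modE) : modE_C).

Lemma act_a_pi (x : modE) :
  act_a (\pi_modE_b (x : modE_C)) = \pi_modE_b (at_a *: x : modE_C).
Proof.
apply/(lquot_eq bE_submod); rewrite -[X in X \in _](scalerBr at_a).
by apply: bE_a_stable; apply/(lquot_eq bE_submod); exact: reprK.
Qed.

Lemma act_a_linear : linear act_a.
Proof.
move=> c; elim/quotW=> x; elim/quotW=> y.
rewrite -(lquot_piP bE_submod c x y) [LHS]act_a_pi [act_a _]act_a_pi.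
rewrite [act_a _]act_a_pi -[RHS](lquot_piP bE_submod).
congr (\pi _); rewrite (scalerDr at_a); congr (_ + _).
by rewrite -[RHS]/(c%:A *: (at_a *: (x : modE))) !scalerA mulr_algl mulr_algr.
Qed.

HB.instance Definition _ := GRing.isLinear.Build K modE_b modE_b _ act_a
  act_a_linear.

End QuotientModule.

End FreeAlgebra.

Arguments act_a {K} P x.

(* Main.v *)
Require Import Defs.
From HB Require Import structures.
From mathcomp Require Import all_boot all_order all_algebra.
From mathcomp Require Import reals.
From mathcomp Require Import complex.
From mathcomp Require Import boolp ring.
From mathcomp.multinomials Require Import monalg.

(* The b-adic graded ring of the completion is commutative, so Hensel's lemma
   holds: since a b = b (a + b), an increment b^n u moves across a monic factor
   f + b (...) without changing f modulo b. Hence, if P = f g modulo b with f and g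
   coprime monic polynomials in a, then the digits of a factorization P = F G are
   found one after the other, the n-th ones by solving u g + f w = r in K[X].
   Modulo b, P is a monic polynomial p0 with E/bE = K[X]/(p0), where a acts as
   multiplication by X; the eigenvalues are the roots of p0, the dimensions of the
   spectral subspaces are their multiplicities, and Hensel's lemma lifts the
   factorization of p0 into powers of the X - v_i. *)

Import GRing.Theory.
Local Open Scope ring_scope.

Set Implicit Arguments.
Unset Strict Implicit.
Unset Printing Implicit Defensive.

(** * Evaluation of polynomials in an algebra *)

Section HornerAlg.
Variables (K : comNzRingType) (A : algType K).
Implicit Types (u : A) (p q : {poly K}) (c : K).

Lemma horner_alg0 u : horner_alg u 0 = 0. Proof. exact: rmorph0. Qed.
Lemma horner_alg1 u : horner_alg u 1 = 1. Proof. exact: rmorph1. Qed.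
Lemma horner_algD u p q : horner_alg u (p + q) = horner_alg u p + horner_alg u q.
Proof. exact: rmorphD. Qed.
Lemma horner_algB u p q : horner_alg u (p - q) = horner_alg u p - horner_alg u q.
Proof. exact: rmorphB. Qed.
Lemma horner_algM u p q : horner_alg u (p * q) = horner_alg u p * horner_alg u q.
Proof. exact: rmorphM. Qed.
Lemma horner_algZ u c p : horner_alg u (c *: p) = c *: horner_alg u p.
Proof. by rewrite linearZ /= mulr_algl. Qed.
Lemma horner_alg_mulX u p : horner_alg u ('X * p) = u * horner_alg u p.
Proof. by rewrite horner_algM horner_algX. Qed.
Lemma horner_algXn u n : horner_alg u 'X^n = u ^+ n.
Proof. by rewrite rmorphXn /= horner_algX. Qed.
Lemma horner_alg_comp u p q :
  horner_alg u (p \Po q) = horner_alg (horner_alg u q) p.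
Proof.
elim/poly_ind: p => [|p c IH]; first by rewrite comp_poly0 !horner_alg0.
rewrite comp_polyD comp_polyM comp_polyX comp_polyC !horner_algD !horner_algM.
by rewrite IH horner_algX !horner_algC.
Qed.

End HornerAlg.

Lemma morph_horner_alg (K : comNzRingType) (A B : algType K) (f : A -> B)
  (u : A) (p : {poly K}) :
  {morph f : x y / x + y} -> {morph f : x y / x * y} ->
  (forall c, f c%:A = c%:A) -> f (horner_alg u p) = horner_alg (f u) p.
Proof.
move=> fD fM fC; elim/poly_ind: p => [|p c IH].
  by rewrite horner_alg0 -(scale0r (1 : A)) fC scale0r horner_alg0.
by rewrite !horner_algD !horner_algM fD fM IH !horner_algX !horner_algC fC.
Qed.

(** * Hensel's lemma for left polynomials *)

Lemma monic_prod_XsubC_exp (K : fieldType) l (v : 'I_l -> K) (d : 'I_l -> nat) :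
  \prod_(i < l) ('X - (v i)%:P) ^+ d i \is monic.
Proof. by apply: monic_prod => i _; apply/monic_exp/monicXsubC. Qed.

Lemma size_prod_XsubC_exp (K : fieldType) l (v : 'I_l -> K) (d : 'I_l -> nat) :
  size (\prod_(i < l) ('X - (v i)%:P) ^+ d i) = (\sum_(i < l) d i).+1.
Proof.
elim: l v d => [|l IH] v d; first by rewrite !big_ord0 size_poly1.
rewrite !big_ord_recl size_Mmonic ?monic_prod_XsubC_exp //; last first.
  by rewrite expf_neq0 // polyXsubC_eq0.
by rewrite IH size_exp_XsubC addSn /= addnS.
Qed.

(** * Left polynomials of bounded degree with power series in [b] as coefficients *)

Section LeftPolynomials.
Variables (K : fieldType) (A : algType K) (b : A).

Implicit Types (u x y z : A) (p q r f g : {poly K}).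

(* Greatest fixed point: [x] is a polynomial of degree < d in u with
   coefficients power series in b, given by its successive b-adic digits. *)
Definition bpoly (u : A) (d : nat) (x : A) : Prop :=
  exists2 X : A -> Prop, X x & forall y, X y -> exists p z,
    [/\ (size p <= d)%N, y = horner_alg u p + b * z & X z].

Lemma bpoly_case u d x : bpoly u d x -> exists p z,
  [/\ (size p <= d)%N, x = horner_alg u p + b * z & bpoly u d z].
Proof.
by case=> X Xx XP; have [p [z [sp -> Xz]]] := XP _ Xx; exists p, z; split=> //; exists X.
Qed.

Lemma bpoly_cons u d p z :
  (size p <= d)%N -> bpoly u d z -> bpoly u d (horner_alg u p + b * z).
Proof.
move=> sp [X Xz XP]; exists (fun y => y = horner_alg u p + b * z \/ X y); first by left.
move=> y [->|/XP[q [t [? ? ?]]]]; first by exists p, z; split=> //; right.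
by exists q, t; split=> //; right.
Qed.

Lemma bpoly0 u d : bpoly u d 0.
Proof.
exists (eq^~ 0) => // y ->; exists 0, 0.
by rewrite size_poly0 horner_alg0 mulr0 addr0.
Qed.

Lemma bpoly_horner u d p : (size p <= d)%N -> bpoly u d (horner_alg u p).
Proof. by move=> sp; rewrite -[horner_alg u p]addr0 -(mulr0 b); apply/bpoly_cons/bpoly0. Qed.

Lemma bpoly_bM u d z : bpoly u d z -> bpoly u d (b * z).
Proof.
move=> Mz; rewrite -[_ * z]add0r -(horner_alg0 u).
by apply: bpoly_cons; rewrite ?size_poly0.
Qed.

Lemma bpolyD u d x y : bpoly u d x -> bpoly u d y -> bpoly u d (x + y).
Proof.
move=> Mx My; exists (fun z => exists x y, [/\ bpoly u d x, bpoly u d y & z = x + y]).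
  by exists x, y.
move=> _ [{Mx}x [{My}y [Mx My ->]]].
have [p [x' [sp -> Mx']]] := bpoly_case Mx; have [q [y' [sq -> My']]] := bpoly_case My.
exists (p + q), (x' + y'); split; last by exists x', y'.
- by apply: leq_trans (size_polyD _ _) _; rewrite geq_max sp.
- by rewrite horner_algD mulrDr addrACA.
Qed.

Lemma bpolyZ u d c x : bpoly u d x -> bpoly u d (c *: x).
Proof.
move=> Mx; exists (fun z => exists2 x, bpoly u d x & z = c *: x); first by exists x.
move=> _ [{Mx}x Mx ->]; have [p [x' [sp -> Mx']]] := bpoly_case Mx.
exists (c *: p), (c *: x'); split; last by exists x'.
- exact: leq_trans (size_scale_leq _ _) sp.
- by rewrite horner_algZ scalerDr scalerAr.
Qed.

Lemma bpolyB u d x y : bpoly u d x -> bpoly u d y -> bpoly u d (x - y).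
Proof. by move=> Mx My; rewrite -scaleN1r; apply: bpolyD => //; apply: bpolyZ. Qed.

Lemma bpoly_leq u d e x : (d <= e)%N -> bpoly u d x -> bpoly u e x.
Proof.
move=> de [X Xx XP]; exists X => // y /XP[p [z [sp ? ?]]].
by exists p, z; split=> //; apply: leq_trans de.
Qed.

Lemma bpoly_shift u c d x : bpoly u d x -> bpoly (u - c%:A) d x.
Proof.
case=> X Xx XP; exists X => // y /XP[p [z [sp -> Xz]]].
exists (p \Po ('X + c%:P)), z; split => //; first by rewrite size_comp_poly2 // size_XaddC.
by rewrite horner_alg_comp horner_algD horner_algX horner_algC subrK.
Qed.

(** * Products of left polynomials and commutation with [b] *)

Section Product.
Variable a : A.
Hypothesis ab : a * b = b * (a + b).

Lemma bpoly_aM d x : bpoly a d x -> bpoly a d.+1 (a * x).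
Proof.
(* Moving [a] across [b] in [a * (b * x')] leaves an extra [b * x'] in the tail; the summand [y]
   absorbs it, so that the set is closed under taking tails. *)
move=> Mx; exists (fun z => exists x y, [/\ bpoly a d x, bpoly a d.+1 y & z = a * x + y]).
  by exists x, 0; rewrite addr0; split=> //; apply: bpoly0.
move=> _ [{Mx}x [y [Mx My ->]]].
have [p [x' [sp -> Mx']]] := bpoly_case Mx; have [q [y' [sq -> My']]] := bpoly_case My.
exists ('X * p + q), (a * x' + (b * x' + y')); split.
- apply: leq_trans (size_polyD _ _) _; rewrite geq_max sq andbT.
  by apply: leq_trans (size_polyMleq _ _) _; rewrite size_polyX.
- rewrite horner_algD horner_alg_mulX mulrDr (mulrA a) ab addrACA; congr (_ + _).
  by rewrite -mulrA -mulrDr mulrDl -addrA.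
- exists x', (b * x' + y'); split=> //; apply: bpolyD => //; apply: bpoly_bM.
  exact: bpoly_leq Mx'.
Qed.

Lemma bpoly_aXM i d x : bpoly a d x -> bpoly a (i + d) (a ^+ i * x).
Proof.
move=> Mx; elim: i => [|i IH]; first by rewrite mul1r.
by rewrite exprS -mulrA addSn; apply: bpoly_aM.
Qed.

Lemma bpoly_hornerM p d e x :
  (size p <= d)%N -> bpoly a e x -> bpoly a (d + e) (horner_alg a p * x).
Proof.
move=> sp Mx; rewrite [horner_alg a p](_ : _ = \sum_(i < size p) p`_i *: a ^+ i).
  rewrite mulr_suml; elim/big_ind: _ => [|y z|i _]; [exact: bpoly0|exact: bpolyD|].
  rewrite -scalerAl; apply: bpolyZ; apply: bpoly_leq (bpoly_aXM i Mx).
  by rewrite leq_add2r; apply: leq_trans (ltnW (ltn_ord i)) sp.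
rewrite -[p in LHS]coefK poly_def linear_sum; apply: eq_bigr => i _.
by rewrite /= horner_algZ horner_algXn.
Qed.

Lemma bpolyM d e x y : bpoly a d x -> bpoly a e y -> bpoly a (d + e) (x * y).
Proof.
move=> Mx My.
(* Only [x] is split into digits: [horner_alg a p * y] is already a left polynomial and joins
   [t]. *)
exists (fun z => exists x t, [/\ bpoly a d x, bpoly a (d + e) t & z = x * y + t]).
  by exists x, 0; rewrite addr0; split=> //; apply: bpoly0.
move=> _ [{Mx}x [t [Mx Mt ->]]]; have [p [x' [sp -> Mx']]] := bpoly_case Mx.
have [q [t' [sq def_t Mt']]] := bpoly_case (bpolyD (bpoly_hornerM sp My) Mt).
exists q, (x' * y + t'); split=> //; last by exists x', t'.
by rewrite mulrDl addrAC def_t mulrDr mulrA addrAC addrA.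
Qed.

(** Moving [b] to the left turns [a ^+ i] into [(a + b) ^+ i], which is [a ^+ i] plus [b] times
    terms of degree less than [i]. This drop in degree keeps monic factors monic. *)
Lemma aX_b i : exists2 m, bpoly a i m & a ^+ i * b = b * (a ^+ i + b * m).
Proof.
elim: i => [|i [m Mm IH]].
  by exists 0; [exact: bpoly0 | rewrite mul1r mulr0 addr0 mulr1].
exists (a ^+ i + a * m + b * m + b * m); last first.
  rewrite exprS -mulrA IH mulrA ab -!mulrA; congr (_ * _).
  rewrite mulrDl (mulrDr a) (mulrA a) ab -addrA -(mulrA b) -mulrDr.
  congr (_ + b * _); rewrite mulrDl addrC -!addrA; congr (_ + _).
  by rewrite addrCA.
have Mm' : bpoly a i.+1 (b * m) by apply/bpoly_bM/(bpoly_leq _ Mm).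
apply: (bpolyD _ Mm'); apply: (bpolyD _ Mm'); apply: (bpolyD _ (bpoly_aM Mm)).
by rewrite -horner_algXn; apply: bpoly_horner; rewrite size_polyXn.
Qed.

Lemma horner_b p d : (size p <= d.+1)%N ->
  exists2 m, bpoly a d m & horner_alg a p * b = b * (horner_alg a p + b * m).
Proof.
move=> sp; rewrite [horner_alg a p](_ : _ = \sum_(i < size p) p`_i *: a ^+ i); last first.
  rewrite -[p in LHS]coefK poly_def linear_sum; apply: eq_bigr => i _.
  by rewrite /= horner_algZ horner_algXn.
elim/big_ind: _ => [|x y [m Mm xE] [n Mn yE]|i _].
- by exists 0; [exact: bpoly0 | rewrite mul0r mulr0 addr0 mulr0].
- by exists (m + n); [exact: bpolyD | rewrite mulrDl xE yE -mulrDr addrACA -mulrDr].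
- have [m Mm mE] := aX_b i; exists (p`_i *: m).
    by apply/bpolyZ/(bpoly_leq _ Mm); rewrite -ltnS; apply: leq_trans (ltn_ord i) sp.
  by rewrite -scalerAl mE scalerAr scalerDr scalerAr.
Qed.

Lemma bpolyMb d x : bpoly a d x -> bpoly a d (x * b).
Proof.
move=> Mx; exists (fun z => exists x y, [/\ bpoly a d x, bpoly a d y & z = x * b + y]).
  by exists x, 0; rewrite addr0; split=> //; apply: bpoly0.
move=> _ [{Mx}x [y [Mx My ->]]].
have [p [x' [sp -> Mx']]] := bpoly_case Mx; have [q [y' [sq -> My']]] := bpoly_case My.
have [m Mm pb] := horner_b (leqW sp).
exists q, (x' * b + (horner_alg a p + b * m + y')); split=> //; last first.
  exists x', (horner_alg a p + b * m + y'); split=> //.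
  by apply: bpolyD => //; apply: bpoly_cons.
by rewrite mulrDl pb -mulrA -mulrDr addrCA -mulrDr (addrC _ (x' * b)) -addrA.
Qed.

Lemma bpoly_b d x : bpoly a d x -> exists2 y, bpoly a d y & x * b = b * y.
Proof.
move=> Mx; have [p [x' [sp -> Mx']]] := bpoly_case Mx; have [m Mm pb] := horner_b (leqW sp).
exists (horner_alg a p + b * m + x' * b); last by rewrite mulrDl pb -mulrA -mulrDr.
by apply: bpolyD; [apply: bpoly_cons | apply: bpolyMb].
Qed.

Lemma bpoly_bX n d x : bpoly a d x -> exists2 y, bpoly a d y & x * b ^+ n = b ^+ n * y.
Proof.
elim: n x => [|n IH] x Mx; first by exists x => //; rewrite mul1r mulr1.
have [y My xE] := bpoly_b Mx; have [z Mz yE] := IH _ My.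
by exists z => //; rewrite exprS mulrA xE -mulrA yE mulrA.
Qed.

(** As [m] has degree less than [d], for [f] monic of degree [d] this makes [x] monic of degree [d]
    in [a], with reduction [f] modulo [b]. *)
Definition lifts (d : nat) (f : {poly K}) (x : A) : Prop :=
  exists2 m, bpoly a d m & x = horner_alg a f + b * m.

(** Each passage of one [b] changes only the correction [m], by [horner_b] and [bpoly_b]. This is
    how an increment crosses a factor in Hensel's lemma. *)
Lemma lifts_bX n d f x : (size f <= d.+1)%N -> lifts d f x ->
  exists2 y, lifts d f y & x * b ^+ n = b ^+ n * y.
Proof.
move=> sf; elim: n x => [|n IH] x fx; first by exists x => //; rewrite mul1r mulr1.
case: fx => m Mm ->; have [m1 Mm1 fb] := horner_b sf; have [m2 Mm2 mb] := bpoly_b Mm.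
have fy : lifts d f (horner_alg a f + b * (m1 + m2)) by exists (m1 + m2) => //; apply: bpolyD.
have [z fz yE] := IH _ fy; exists z => //.
rewrite !exprS mulrA -[RHS]mulrA -yE mulrA; congr (_ * _).
by rewrite mulrDl fb -mulrA mb -mulrDr -addrA -mulrDr.
Qed.

(** * Digit expansions as power series, and Hensel's lemma *)

Section Hensel.
Hypothesis separated : forall x : A, (forall n, exists y, x = b ^+ n * y) -> x = 0.
Variable ser : (nat -> K) -> A.
Hypothesis ser_recl :
  forall c : nat -> K, ser c = (c 0%N)%:A + b * ser (fun n => c n.+1).

Lemma bpoly_bXM n u d x : bpoly u d x -> bpoly u d (b ^+ n * x).
Proof.
move=> Mx; elim: n => [|n IH]; first by rewrite mul1r.
by rewrite exprS -mulrA; apply: bpoly_bM.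
Qed.

(** For [p n] of size at most [d], this is the infinite sum of the [b ^+ n * horner_alg u (p n)],
    regrouped by powers of [u]. *)
Definition digit_series u d (p : nat -> {poly K}) : A :=
  \sum_(i < d) ser (fun n => (p n)`_i) * u ^+ i.

Lemma horner_alg_sum u d p : (size p <= d)%N ->
  horner_alg u p = \sum_(i < d) p`_i *: u ^+ i.
Proof.
move=> sp; rewrite -[p in LHS](coefK p) poly_def.
rewrite (big_ord_widen d (fun i => p`_i *: 'X^i : {poly K}) sp) big_mkcond linear_sum.
apply: eq_bigr => i _ /=; case: ltnP => [_|/leq_sizeP pi].
  by rewrite horner_algZ horner_algXn.
by rewrite horner_alg0 pi // scale0r.
Qed.

Lemma digit_series_recl u d (p : nat -> {poly K}) : (forall n, size (p n) <= d)%N ->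
  digit_series u d p = horner_alg u (p 0%N) + b * digit_series u d (fun n => p n.+1).
Proof.
move=> sp; rewrite (horner_alg_sum _ (sp _)) /digit_series mulr_sumr -big_split.
by apply: eq_bigr => i _ /=; rewrite ser_recl mulrDl mulr_algl -mulrA.
Qed.

Lemma bpoly_digit_series u d (p : nat -> {poly K}) : (forall n, size (p n) <= d)%N ->
  bpoly u d (digit_series u d p).
Proof.
move=> sp; exists (fun x => exists2 p : nat -> {poly K}, forall n, (size (p n) <= d)%N & x = digit_series u d p).
  by exists p.
move=> _ [q sq ->]; exists (q 0%N), (digit_series u d (fun n => q n.+1)).
by split=> //; [exact: digit_series_recl | exists (fun n => q n.+1)].
Qed.

Lemma bpolyP u d x : bpoly u d x ->
  exists c : 'I_d -> nat -> K, x = \sum_(i < d) ser (c i) * u ^+ i.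
Proof.
move=> Mx.
have [phi phiP] : exists phi : A -> {poly K} * A, forall y, bpoly u d y ->
    [/\ (size (phi y).1 <= d)%N, y = horner_alg u (phi y).1 + b * (phi y).2
      & bpoly u d (phi y).2].
  (* Choice yields a total function giving the first digit and the tail; outside [bpoly] the value
     [(0, 0)] is a dummy. *)
  have /choice[phi phiP] : forall y, exists pz : {poly K} * A, bpoly u d y ->
      [/\ (size pz.1 <= d)%N, y = horner_alg u pz.1 + b * pz.2 & bpoly u d pz.2].
    move=> y; have [/bpoly_case[p [z ?]]|nMy] := EM (bpoly u d y).
      by exists (p, z).
    by exists (0, 0) => /nMy.
  by exists phi.
pose tl n := iter n (fun y => (phi y).2) x; pose p n := (phi (tl n)).1.
have Mtl n : bpoly u d (tl n).
  by elim: n => // n /phiP[_ _]; rewrite /tl iterS.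
have sp n : (size (p n) <= d)%N by have [] := phiP _ (Mtl n).
exists (fun i n => (p n)`_i); apply/eqP; rewrite -subr_eq0; apply/eqP/separated => n.
(* Both sides share their first [n] digits, so their difference is [b ^+ n] times the difference of
   the tails. *)
exists (tl n - digit_series u d (fun m => p (n + m)%N)).
elim: n => [|n ->]; first by rewrite mul1r.
have sp' m : (size (p (n + m)) <= d)%N by [].
have [_ -> _] := phiP _ (Mtl n).
rewrite (digit_series_recl _ sp') addn0 opprD addrACA subrr add0r -mulrBr mulrA -exprSr.
rewrite (_ : (phi (tl n)).2 = tl n.+1) //; congr (_ * (_ - digit_series _ _ _)).
by apply/funext => m; rewrite addnS.
Qed.

Lemma size_sub_monic f g : f \is monic -> g \is monic -> size f = size g ->
  (size (f - g)%R < size f)%N.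
Proof.
move=> f1 g1 sfg; have f0 : (0 < size f)%N by rewrite size_poly_gt0 monic_neq0.
rewrite -(prednK f0) ltnS; apply/leq_sizeP => j; rewrite leq_eqVlt coefB => /orP[/eqP <-|].
  by rewrite {2}sfg -!lead_coefE (monicP f1) (monicP g1) subrr.
by rewrite (prednK f0) => fj; rewrite !nth_default ?subrr // -sfg.
Qed.

(** Subtracting [(a - c%:A) ^+ d] cancels the leading term, both reductions modulo [b] being monic
    of degree [d]; the rest can be expanded in [a - c%:A] by [bpoly_shift]. *)
Lemma lifts_monic d f x c : f \is monic -> size f = d.+1 -> lifts d f x ->
  exists e : 'I_d -> nat -> K,
    x = (a - c%:A) ^+ d + \sum_(i < d) ser (e i) * (a - c%:A) ^+ i.
Proof.
move=> f_monic sf [m Mm xE]; set u := a - c%:A.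
suff /bpolyP[e eE] : bpoly u d (x - u ^+ d) by exists e; rewrite -eE addrC subrK.
have -> : x - u ^+ d = horner_alg a (f - ('X - c%:P) ^+ d) + b * m.
  rewrite horner_algB rmorphXn /= horner_algB horner_algX horner_algC xE.
  by rewrite addrAC.
apply/bpoly_shift/bpoly_cons => //; rewrite -ltnS -[X in (_ < X)%N]sf.
apply: size_sub_monic => //; first exact/monic_exp/monicXsubC.
by rewrite sf size_exp_XsubC.
Qed.

Lemma monic_lifts d (c : 'I_d -> nat -> K) : exists f,
  [/\ f \is monic, size f = d.+1 & lifts d f (a ^+ d + \sum_(i < d) ser (c i) * a ^+ i)].
Proof.
(* [q n] collects the coefficients of [b ^+ n] in all the [c i]: [q 0] enters [f], the later ones
   form the correction. *)
pose q n := \poly_(i < d) (if insub i is Some j then c j n else 0).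
have sq n : (size (q n) <= d)%N by apply: size_poly.
have sX : (size (q 0%N) < size ('X^d : {poly K}))%N by rewrite size_polyXn ltnS.
exists ('X^d + q 0%N); split.
- by rewrite monicE lead_coefDl // lead_coefXn.
- by rewrite size_polyDl // size_polyXn.
exists (digit_series a d (fun n => q n.+1)); first exact: bpoly_digit_series.
rewrite horner_algD horner_algXn -addrA -digit_series_recl //.
congr (_ + _); apply: eq_bigr => i _; congr (ser _ * _).
by apply/funext => n; rewrite coef_poly ltn_ord valK.
Qed.

(** * Lifting a factorization into two coprime factors *)

Section Step.
Variables (df dg : nat) (f g : {poly K}).
Hypotheses (sf : size f = df.+1) (sg : size g = dg.+1).
Hypothesis (fg : coprimep f g).

(** In a Bezout relation multiplied by [r], the coefficient of [g] is reduced modulo [f] and the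
    quotient is moved into the coefficient of [f]. The bound on [w] follows from [f * w = r - u * g]
    by degrees. *)
Lemma bezout_size r : (size r <= df + dg)%N -> exists u w : {poly K},
  [/\ (size u <= df)%N, (size w <= dg)%N & u * g + f * w = r].
Proof.
have f0 : f != 0 by rewrite -size_poly_eq0 sf.
move=> sr; have [[w0 u0] /= uw] := Bezout_eq1_coprimepP _ _ fg.
exists ((r * u0) %% f), ((r * w0) + (r * u0) %/ f * g).
have e : r * u0 %% f * g + f * (r * w0 + r * u0 %/ f * g) = r.
  rewrite -[RHS]mulr1 -uw [RHS]mulrDr mulrA [X in _ = _ + X]mulrA.
  rewrite [X in _ = _ + X * _](divp_eq _ f); ring.
have su : (size ((r * u0) %% f)%R <= df)%N by rewrite -ltnS -sf ltn_modp.
split=> //; set w := r * w0 + _ in e *.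
have [w_eq0|w0n] := eqVneq w 0; first by rewrite w_eq0 size_poly0.
have : (size (f * w)%R <= df + dg)%N.
  rewrite (_ : f * w = r - (r * u0) %% f * g); last by rewrite -[X in X - _]e addrC addKr.
  apply: leq_trans (size_polyD _ _) _; rewrite size_polyN geq_max sr.
  apply: leq_trans (size_polyMleq _ _) _; rewrite sg addnS /= .
  by rewrite leq_add2r.
by rewrite size_mul // sf addSn /= leq_add2l.
Qed.

Definition hensel_approx P n (s : A * A) : Prop :=
  [/\ lifts df f s.1, lifts dg g s.2
    & exists2 x, bpoly a (df + dg) x & P - s.1 * s.2 = b ^+ n.+1 * x].

Lemma lifts_addb d h n x y :
  lifts d h x -> bpoly a d y -> lifts d h (x + b ^+ n.+1 * y).
Proof.
move=> [m Mm ->] My; exists (m + b ^+ n * y).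
  by apply: bpolyD => //; apply: bpoly_bXM.
by rewrite exprS -mulrA -addrA -mulrDr.
Qed.

Lemma hensel_step P n s : hensel_approx P n s -> exists uw : {poly K} * {poly K},
  [/\ (size uw.1 <= df)%N, (size uw.2 <= dg)%N
    & hensel_approx P n.+1 (s.1 + b ^+ n.+1 * horner_alg a uw.1,
                            s.2 + b ^+ n.+1 * horner_alg a uw.2)].
Proof.
case: s => F G [/= lF lG [x Mx PFG]].
have [r [x' [sr xE Mx']]] := bpoly_case Mx.
(* [r] is the lowest digit of the error, and [u * g + f * w] is the first-order effect of the
   increments modulo [b]. *)
have [u [w [su sw uw]]] := bezout_size sr.
exists (u, w); split=> //; split=> /=; [| |].
- by apply: lifts_addb => //; apply: bpoly_horner.
- by apply: lifts_addb => //; apply: bpoly_horner.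
set U := horner_alg a u; set W := horner_alg a w; set B := b ^+ n.+1.
have MU : bpoly a df U by apply: bpoly_horner.
have MW : bpoly a dg W by apply: bpoly_horner.
have [F1 [m1 Mm1 F1E] FB] : exists2 y, lifts df f y & F * B = B * y.
  by apply: lifts_bX lF; rewrite sf.
have [U2 MU2 U2E] := bpoly_bX n.+1 MU; rewrite -/B in U2E.
have [U3 MU3 U3E] := bpoly_b MU.
case: lG => mg Mmg GE.
(* After [r] cancels, there remain the tail of the error, the corrections from [U * G] and [F1 * W],
   and the second-order product of the increments. *)
exists (x' - U3 * mg - m1 * W - b ^+ n * (U2 * W)).
  do ![apply: bpolyB] => //; last apply: bpoly_bXM; exact: bpolyM.
have -> : P - (F + B * U) * (G + B * W) =
    P - F * G - B * (U * G + F1 * W + B * (U2 * W)).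
  rewrite mulrDl !mulrDr !opprD !addrA !(mulrA F) FB -!mulrA (mulrA U) U2E -!mulrA.
  by rewrite -!addrA; do 2!congr (_ + _); rewrite addrCA.
rewrite PFG -/B -mulrBr [b ^+ n.+2]exprSr -mulrA; congr (_ * _).
rewrite xE GE F1E -uw horner_algD !horner_algM -/U -/W mulrDr mulrDl /B.
rewrite (mulrA U) U3E exprS -!mulrA !mulrBr.
set p := U * _; set q := _ * W; set t := b * _; set y := b * _; set z := b * _; set v := b * _.
rewrite !opprD [- p - v + _]addrACA -(opprD p q) -(addrA (- (p + q))).
by rewrite addrACA subrr add0r !addrA.
Qed.

Lemma hensel P : lifts (df + dg) (f * g) P ->
  exists F G, [/\ lifts df f F, lifts dg g G & P = F * G].
Proof.
move=> [x0 Mx0 PE].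
have [phi phiP] : exists phi : nat -> A * A -> {poly K} * {poly K},
    forall n s, hensel_approx P n s ->
    [/\ (size (phi n s).1 <= df)%N, (size (phi n s).2 <= dg)%N
      & hensel_approx P n.+1 (s.1 + b ^+ n.+1 * horner_alg a (phi n s).1,
                              s.2 + b ^+ n.+1 * horner_alg a (phi n s).2)].
  have /choice[phi phiP] : forall ns : nat * (A * A), exists uw : {poly K} * {poly K},
      hensel_approx P ns.1 ns.2 ->
      [/\ (size uw.1 <= df)%N, (size uw.2 <= dg)%N
        & hensel_approx P ns.1.+1 (ns.2.1 + b ^+ ns.1.+1 * horner_alg a uw.1,
                                  ns.2.2 + b ^+ ns.1.+1 * horner_alg a uw.2)].
    move=> [n s]; have [/hensel_step[uw ?]|nH] := EM (hensel_approx P n s).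
      by exists uw.
    by exists (0, 0) => /nH.
  by exists (fun n s => phi (n, s)) => n s; apply: (phiP (n, s)).
pose next n s := (s.1 + b ^+ n.+1 * horner_alg a (phi n s).1,
                  s.2 + b ^+ n.+1 * horner_alg a (phi n s).2).
pose st := fix st n := if n is m.+1 then next m (st m)
                       else (horner_alg a f, horner_alg a g).
have stP n : hensel_approx P n (st n).
  elim: n => [|n /phiP[] //]; split=> /=.
  - by exists 0; [exact: bpoly0 | rewrite mulr0 addr0].
  - by exists 0; [exact: bpoly0 | rewrite mulr0 addr0].
  - by exists x0 => //; rewrite PE horner_algM addrC addKr.
pose u n := (phi n (st n)).1; pose w n := (phi n (st n)).2.
have su n : (size (u n) <= df)%N by have [] := phiP _ _ (stP n).
have sw n : (size (w n) <= dg)%N by have [] := phiP _ _ (stP n).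
(* [X n] and [Y n] sum all increments from stage [n] on, divided by [b ^+ n.+1]; the limit factors
   are built from [X 0] and [Y 0]. *)
pose X n := digit_series a df (fun m => u (n + m)%N).
pose Y n := digit_series a dg (fun m => w (n + m)%N).
have XE n : X n = horner_alg a (u n) + b * X n.+1.
  rewrite /X digit_series_recl // addn0; congr (_ + b * digit_series _ _ _).
  by apply/funext => m; rewrite addnS.
have YE n : Y n = horner_alg a (w n) + b * Y n.+1.
  rewrite /Y digit_series_recl // addn0; congr (_ + b * digit_series _ _ _).
  by apply/funext => m; rewrite addnS.
have FE n : horner_alg a f + b * X 0%N = (st n).1 + b ^+ n.+1 * X n.
  elim: n => [|n ->]; first by rewrite expr1.
  by rewrite /= XE mulrDr addrA mulrA -exprSr.
have GE n : horner_alg a g + b * Y 0%N = (st n).2 + b ^+ n.+1 * Y n.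
  elim: n => [|n ->]; first by rewrite expr1.
  by rewrite /= YE mulrDr addrA mulrA -exprSr.
exists (horner_alg a f + b * X 0%N), (horner_alg a g + b * Y 0%N); split.
- by exists (X 0%N) => //; apply: bpoly_digit_series.
- by exists (Y 0%N) => //; apply: bpoly_digit_series.
(* The limits agree with stage [n] modulo [b ^+ n.+1], so [P - F * G] is divisible by every power of
   [b]. *)
apply/eqP; rewrite -subr_eq0; apply/eqP/separated => n; rewrite (FE n) (GE n).
have [lF lG [x _ Px]] := stP n; have [y _ FB] := lifts_bX n.+1 (eq_leq sf) lF.
exists (b * (x - X n * ((st n).2 + b ^+ n.+1 * Y n) - y * Y n)).
rewrite mulrDl opprD addrA (mulrDr (st n).1) opprD addrA Px (mulrA (st n).1) FB.
by rewrite addrAC -!mulrA -!mulrBr mulrA -exprSr.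
Qed.

End Step.

(** The leftmost factor is split off by [hensel], its reduction being coprime to the product of the
    others; the right factor satisfies the hypothesis for the remaining [v i]. *)
Lemma hensel_prod l (v : 'I_l -> K) (d : 'I_l -> nat) P : injective v ->
  lifts (\sum_(i < l) d i) (\prod_(i < l) ('X - (v i)%:P) ^+ d i) P ->
  exists Q : 'I_l -> A,
    (forall i, lifts (d i) (('X - (v i)%:P) ^+ d i) (Q i)) /\ P = \prod_(i < l) Q i.
Proof.
elim: l v d P => [|l IH] v d P v_inj.
  rewrite !big_ord0 => -[m Mm ->]; exists (fun=> 0); split; first by case.
  (* With no factors, the correction is an empty sum, so [P = 1]. *)
  have [c ->] := bpolyP Mm.
  by rewrite !big_ord0 mulr0 addr0 horner_alg1.
rewrite !big_ord_recl => lP.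
have cop : coprimep (('X - (v ord0)%:P) ^+ d ord0)
    (\prod_(i < l) ('X - (v (lift ord0 i))%:P) ^+ d (lift ord0 i)).
  apply: coprimep_expl; elim/big_ind: _ => [|p q cp cq|i _]; first exact: coprimep1.
    by rewrite coprimepMr cp.
  apply/coprimep_expr/coprimep_XsubC2; rewrite subr_eq0 (inj_eq v_inj).
  by rewrite eq_sym neq_lift.
have [F [G [lF lG ->]]] :=
  hensel (size_exp_XsubC _ _) (size_prod_XsubC_exp _ _) cop lP.
have [Q [lQ ->]] := IH _ _ _ (inj_comp v_inj lift_inj) lG.
exists (fun i => if unlift ord0 i is Some j then Q j else F); split.
  by move=> i; case: unliftP => [j|] ->.
rewrite big_ord_recl unlift_none; congr (_ * _); apply: eq_bigr => i _.
by rewrite liftK.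
Qed.

End Hensel.
End Product.
End LeftPolynomials.

(** * Dimensions and cyclic modules *)

Section Dimension.
Variables (K : fieldType) (V : lmodType K).

(** Independence of the [e i] forces the rows of their coordinate matrix to be independent, so its
    rank [d] is at most [m]. *)
Lemma free_span_leq d m (e : 'I_d -> V) (f : 'I_m -> V) :
  (forall c : 'I_d -> K, \sum_(i < d) c i *: e i = 0 -> forall i, c i = 0) ->
  (forall i, exists c : 'I_m -> K, e i = \sum_(j < m) c j *: f j) -> (d <= m)%N.
Proof.
move=> e_free /choice[c cE]; pose M : 'M[K]_(d, m) := \matrix_(i, j) c i j.
suff /eqP <- : row_free M by apply: rank_leq_col.
apply: inj_row_free => x xM; apply/rowP => i; rewrite mxE; apply: e_free.
rewrite (eq_bigr (fun i => \sum_(j < m) (x ord0 i * M i j) *: f j)); last first.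
  by move=> k _; rewrite cE scaler_sumr; apply: eq_bigr => j _; rewrite scalerA mxE.
rewrite exchange_big big1 // => j _; rewrite -scaler_suml.
by have /rowP/(_ j) := xM; rewrite !mxE => ->; rewrite scale0r.
Qed.

Lemma has_dim_leq (S : V -> Prop) d m : has_dim S d -> has_dim S m -> (d <= m)%N.
Proof.
move=> [e [e_free eS]] [f [f_free fS]]; apply: (free_span_leq e_free) => i.
apply/fS/eS; exists (fun j => (j == i)%:R).
rewrite (bigD1 i) //= eqxx scale1r big1 ?addr0 // => j /negbTE ->.
by rewrite scale0r.
Qed.

Lemma has_dim_uniq (S : V -> Prop) d m : has_dim S d -> has_dim S m -> d = m.
Proof. by move=> Sd Sm; apply/eqP; rewrite eqn_leq !(has_dim_leq (S := S)). Qed.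

End Dimension.

(** * The module [K[X]/(p0)], presented by [theta], with [T] acting as multiplication by [X] *)

Section CyclicModule.
Variables (K : fieldType) (V : lmodType K) (T : V -> V) (p0 : {poly K}).
Variable theta : {poly K} -> V.
Implicit Types (p q h : {poly K}).
Hypothesis theta_linear : forall c p q, theta (c *: p + q) = c *: theta p + theta q.
Hypothesis theta_surj : forall x, exists p, x = theta p.
Hypothesis theta_eq0 : forall p, theta p = 0 <-> p0 %| p.
Hypothesis T_theta : forall p, T (theta p) = theta ('X * p).

Lemma theta0 : theta 0 = 0.
Proof. by apply/theta_eq0/dvdp0. Qed.

Lemma theta_sum n (c : 'I_n -> K) (p : 'I_n -> {poly K}) :
  theta (\sum_(i < n) c i *: p i) = \sum_(i < n) c i *: theta (p i).
Proof.
elim: n c p => [|n IH] c p; first by rewrite !big_ord0 theta0.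
by rewrite !big_ord_recl theta_linear IH.
Qed.

Lemma T_sub_theta z p : T (theta p) - z *: theta p = theta (('X - z%:P) * p).
Proof.
rewrite T_theta mulrBl mul_polyC -scaleNr addrC -theta_linear.
by congr theta; rewrite scaleNr addrC.
Qed.

Lemma iter_theta z n p :
  iter n (fun y => T y - z *: y) (theta p) = theta (('X - z%:P) ^+ n * p).
Proof.
elim: n => [|n IH]; first by rewrite mul1r.
by rewrite iterS IH T_sub_theta mulrA -exprS.
Qed.

(** If [z] is not a root, [X - z] is coprime to [p0] and cancels from [p0 %| (X - z) * p]. If
    [p0 = h * (X - z)], the class of [h] is an eigenvector, nonzero by degree. *)
Lemma eigenvalue_root z : p0 != 0 -> is_eigenvalue T z <-> root p0 z.
Proof.
move=> p0n; split.
  case=> x; have [p ->] := theta_surj x => pn0 /eqP; rewrite -subr_eq0 T_sub_theta.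
  move=> /eqP/theta_eq0 dv; apply: contra_neqT pn0 => nr; apply/theta_eq0.
  by rewrite Gauss_dvdpr // coprimep_XsubC in dv.
rewrite -dvdp_XsubCl => /dvdpP[h p0E]; exists (theta h).
  apply/eqP => /theta_eq0 /dvdp_leq hp; have hn : h != 0.
    by apply: contraNneq p0n => h0; rewrite p0E h0 mul0r.
  by have := hp hn; rewrite p0E size_Mmonic ?monicXsubC // size_XsubC addn2 ltnn.
by apply/eqP; rewrite -subr_eq0 T_sub_theta; apply/eqP/theta_eq0; rewrite p0E mulrC.
Qed.

(** As [h] is coprime to [X - z], a class killed by a power of [X - z] is a multiple of [h], with
    cofactor determined modulo [(X - z) ^+ m]: the [h * 'X^i] with [i < m] give a basis. *)
Lemma has_dim_spectral z m h : p0 != 0 -> p0 = ('X - z%:P) ^+ m * h -> ~~ root h z ->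
  has_dim (spectral_space T z) m.
Proof.
move=> p0n p0E hz; exists (fun i => theta (h * 'X^i)).
have hn : h != 0 by apply: contraNneq p0n => h0; rewrite p0E h0 mulr0.
pose pol (c : 'I_m -> K) := \poly_(i < m) (if insub i is Some j then c j else 0).
have polE c (i : 'I_m) : (pol c)`_i = c i by rewrite coef_poly ltn_ord valK.
have comb c : \sum_(i < m) c i *: theta (h * 'X^i) = theta (h * pol c).
  rewrite -theta_sum /pol poly_def mulr_sumr; congr theta; apply: eq_bigr => i _.
  by rewrite scalerAr valK.
split=> [c|x].
  rewrite comb => /theta_eq0; rewrite p0E mulrC dvdp_mul2l // => dv.
  have q0 : pol c = 0.
    apply/eqP; apply: contraT => /dvdp_leq /(_ dv).
    by rewrite size_exp_XsubC ltnNge size_poly.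
  by move=> i; rewrite -polE q0 coef0.
split=> [[n]|[c ->]]; last first.
  exists m; rewrite comb iter_theta; apply/theta_eq0.
  by rewrite mulrA -p0E dvdp_mulr.
have [q ->] := theta_surj x; rewrite iter_theta => /theta_eq0 dv.
have /dvdpP[s qE] : h %| q.
  rewrite -(@Gauss_dvdpr _ q (('X - z%:P) ^+ n)); last first.
    by apply: coprimep_expr; rewrite coprimep_XsubC.
  by apply: dvdp_trans dv; rewrite p0E dvdp_mull.
pose t := s %% ('X - z%:P) ^+ m.
have st : (size t <= m)%N.
  by rewrite -ltnS -(size_exp_XsubC m z) ltn_modp expf_neq0 // polyXsubC_eq0.
exists (fun i => t`_i); rewrite comb.
have -> : pol (fun i => t`_i) = t.
  apply/polyP => i; rewrite coef_poly; case: ltnP => [im|mi].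
    by rewrite insubT.
  by rewrite nth_default // (leq_trans st).
apply/eqP; rewrite -subr_eq0 addrC -scaleN1r -theta_linear; apply/eqP/theta_eq0.
rewrite scaleN1r addrC qE (divp_eq s (('X - z%:P) ^+ m)) -/t mulrDl (mulrC t) addrK.
by rewrite -mulrA -p0E dvdp_mull.
Qed.

End CyclicModule.

Lemma prod_XsubC_count (K : fieldType) l (v : 'I_l -> K) (r : seq K) :
  injective v -> (forall z, z \in r -> exists i, z = v i) ->
  \prod_(z <- r) ('X - z%:P) = \prod_(i < l) ('X - (v i)%:P) ^+ count_mem (v i) r.
Proof.
move=> v_inj; elim: r => [|z r IH] rv; first by rewrite big_nil big1.
rewrite big_cons IH => [|y yr]; last by apply: rv; rewrite inE yr orbT.
have [i zE] := rv z (mem_head _ _).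
rewrite (bigD1 i) //= [RHS](bigD1 i) //= zE eqxx exprS mulrA; congr (_ * _).
by apply: eq_bigr => j ji; rewrite (inj_eq v_inj) eq_sym (negbTE ji).
Qed.

(** * The completed algebra *)

Lemma add_sum_recr (V : zmodType) (y : V) (g : nat -> V) n :
  y + \sum_(j < n.+1) g j = y + \sum_(j < n) g j + g n.
Proof. by rewrite big_ord_recr /= addrA. Qed.

Section Completion.
Variable K : comNzRingType.

Local Notation At := (algAt K).
Local Notation a := (at_a K).
Local Notation b := (at_b K).

Lemma to_algAt1 : to_algAt 1 = 1 :> At.
Proof. by congr (\pi_(algAt K)%qT _); apply: val_inj. Qed.

Lemma to_algAtD : {morph @to_algAt K : x y / x + y}.
Proof.
by move=> x y; rewrite /to_algAt -algquot_piD; congr (\pi_(algAt K)%qT _); apply: val_inj.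
Qed.

Lemma to_algAtZ c x : to_algAt (c *: x) = c *: to_algAt x :> At.
Proof.
by rewrite /to_algAt -algquot_piZ; congr (\pi_(algAt K)%qT _); apply: val_inj.
Qed.

Lemma to_algAtX n x : to_algAt (x ^+ n) = to_algAt x ^+ n :> At.
Proof. by elim: n => [|n IH]; rewrite ?expr0 ?to_algAt1 // !exprS to_algAtM IH. Qed.

Lemma algAt_eq (s t : cauchy_seq K) :
  (\pi_(algAt K)%qT s = \pi_(algAt K)%qT t) <->
  (forall n, exists N, forall i, (N <= i)%N -> cauchy_val s i - cauchy_val t i \in bideal n).
Proof.
split; first by move/algquot_eq => /asboolP.
by move=> st; apply/algquot_eq/asboolP.
Qed.

Lemma algAtW (Q : At -> Prop) :
  (forall s, Q (\pi_(algAt K)%qT s)) -> forall x, Q x.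
Proof. by move=> Qs; elim/quotW. Qed.

Lemma bideal_mul n (x : algA K) : gen_b K ^+ n * x \in bideal n.
Proof. by apply/asboolP; exists x. Qed.

Lemma bideal_leq m n (x : algA K) : (m <= n)%N -> x \in bideal n -> x \in bideal m.
Proof.
move=> mn /asboolP[y ->]; rewrite -(subnKC mn) exprD -mulrA; exact: bideal_mul.
Qed.

(** A representative of [b ^+ n * y] has its terms in [bideal n] up to a null sequence; so a
    representative of [x] is eventually in every [bideal n], that is, null. *)
Lemma at_separated (x : At) : (forall n, exists y, x = b ^+ n * y) -> x = 0.
Proof.
elim/algAtW: x => s sb.
have -> : 0 = \pi_(algAt K)%qT (CauchySeq (const_cauchy (0 : algA K))).
  by rewrite -[LHS](subrr (to_algAt 0)) -to_algAtB subrr.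
apply/algAt_eq => n; have [y] := sb n; elim/algAtW: y => y.
rewrite /at_b -to_algAtX -algquot_piM => /algAt_eq /(_ n)[N sN].
exists N => i /sN; rewrite subr0 cauchy_valM /= => si.
by rewrite -[cauchy_val s i](subrK (gen_b K ^+ n * cauchy_val y i)); apply: bidealD (bideal_mul _ _).
Qed.

Lemma bseries_recl (f : nat -> K) :
  bseries f = (f 0%N)%:A + b * bseries (fun n => f n.+1).
Proof.
rewrite -to_algAt1 -to_algAtZ /at_b -algquot_piM -algquot_piD.
apply/algAt_eq => n; exists n => i ni.
(* Multiplication by [b] shifts the length of partial sums by one, so the two sequences differ by
   the single term of index [i >= n]. *)
rewrite [X in _ - X](_ : _ = \sum_(j < i.+1) f j *: gen_b K ^+ j).
  rewrite /= big_ord_recr opprD addrA subrr sub0r -sub0r.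
  apply: bidealB (bideal0 _ _) _; apply: bidealZ; apply: bideal_leq ni _.
  by rewrite -[X in X \in _]mulr1; apply: bideal_mul.
change (f 0%N *: 1 + gen_b K * (\sum_(j < i) f j.+1 *: gen_b K ^+ j) =
  \sum_(j < i.+1) f j *: gen_b K ^+ j).
rewrite big_ord_recl expr0 mulr_sumr; congr (_ + _); apply: eq_bigr => j _.
by rewrite -scalerAr -exprS.
Qed.

Lemma algA_modb (x : algA K) :
  exists p y, x = horner_alg (gen_a K) p + gen_b K * y.
Proof.
elim/algA_ind: x => [|_ _ [p [y ->]] [q [z ->]]|c _ [p [y ->]]|_ [p [y ->]]|x _].
- by exists 1, 0; rewrite horner_alg1 mulr0 addr0.
- by exists (p + q), (y + z); rewrite horner_algD mulrDr addrACA.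
- by exists (c *: p), (c *: y); rewrite horner_algZ -scalerAr scalerDr.
- exists ('X * p), ((gen_a K + gen_b K) * y).
  have := gen_a_bX K 1; rewrite expr1 mulr1n => ab.
  by rewrite horner_alg_mulX mulrDr !mulrA ab.
- by exists 0, x; rewrite horner_alg0 add0r.
Qed.

Lemma to_algAt_horner p :
  to_algAt (horner_alg (gen_a K) p) = horner_alg a p :> At.
Proof.
apply: morph_horner_alg; [exact: to_algAtD | exact: to_algAtM | move=> c].
by rewrite to_algAtZ to_algAt1.
Qed.

(* The termwise quotients by b of a Cauchy sequence need not be Cauchy, so the
   sequence is first replaced by a subsequence whose n-th increment lies in
   [b^n A]; the quotient is then a telescoping sum. *)
Lemma at_modb (x : At) : exists p y, x = horner_alg a p + b * y.
Proof.
elim/algAtW: x => s.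
have [N sN] : exists N : nat -> nat, forall n i j, (N n <= i)%N -> (N n <= j)%N ->
    cauchy_val s i - cauchy_val s j \in bideal n.
  have /asboolP /choice[N NP] := cauchy_valP s.
  by exists N => n i j; apply: NP.
(* Summing makes [M] monotone while keeping [N n <= M n]. *)
pose M n := (\sum_(i < n.+1) N i)%N.
have NM n : (N n <= M n)%N by rewrite /M big_ord_recr leq_addl.
have MM n m : (n <= m)%N -> (M n <= M m)%N.
  move/subnKC <-; elim: (m - n)%N => [|k IH]; first by rewrite addn0.
  by rewrite addnS; apply: leq_trans IH _; rewrite /M [X in (_ <= X)%N]big_ord_recr leq_addr.
have [z zP] : exists z : nat -> algA K, forall n,
    cauchy_val s (M n.+1) - cauchy_val s (M n) = gen_b K ^+ n * z n.
  have /choice[z zP] : forall n, exists z, cauchy_val s (M n.+1) - cauchy_val s (M n) = gen_b K ^+ n * z.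
    by move=> n; apply/asboolP/(sN n) => //; apply: leq_trans (NM n) (MM _ _ _).
  by exists z.
(* The start is [M 1], since the increment from [M 0] need not be divisible by [b]; all later ones
   are, hence the [z j.+1] in [w]. *)
have [p [y yP]] := algA_modb (cauchy_val s (M 1%N)).
pose w n := y + \sum_(j < n) gen_b K ^+ j * z j.+1.
have wC : w \in @cauchy K.
  have wle n i k : (n <= i)%N -> w (i + k)%N - w i \in bideal n.
    move=> ni; elim: k => [|k IH]; first by rewrite addn0 subrr bideal0.
    have -> : w (i + k.+1)%N = w (i + k)%N + gen_b K ^+ (i + k) * z (i + k).+1.
      by rewrite addnS; apply: (add_sum_recr y (fun j => gen_b K ^+ j * z j.+1)).
    rewrite addrAC; apply: bidealD => //.
    by apply: bideal_leq (bideal_mul _ _); apply: leq_trans ni (leq_addr _ _).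
  apply/asboolP => n; exists n => i j ni nj.
  have -> : w i - w j = (w i - w n) - (w j - w n) by rewrite opprB addrA subrK.
  by apply: bidealB; [rewrite -(subnKC ni)|rewrite -(subnKC nj)]; apply: wle.
exists p, (\pi_(algAt K)%qT (CauchySeq wC)).
rewrite -to_algAt_horner /at_b -algquot_piM -algquot_piD.
apply/algAt_eq => n; exists (maxn (N n) n) => i; rewrite geq_max => /andP[Ni ni].
rewrite [X in _ - X](_ : _ = cauchy_val s (M i.+1)).
  by apply: sN => //; apply: leq_trans (NM n) (MM _ _ _); apply: leq_trans ni _.
change (horner_alg (gen_a K) p + gen_b K * w i = cauchy_val s (M i.+1)).
elim: i {Ni ni} => [|i IH]; first by rewrite /w big_ord0 addr0 -yP.
rewrite -(subrK (cauchy_val s (M i.+1)) (cauchy_val s (M i.+2))) zP -IH exprS -mulrA.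
have -> : w i.+1 = w i + gen_b K ^+ i * z i.+1.
  exact: (add_sum_recr y (fun j => gen_b K ^+ j * z j.+1)).
rewrite (mulrDr (gen_b K) (w i)).
rewrite [RHS]addrC.
by rewrite -addrA.
Qed.

End Completion.

(** * Reduction modulo [b] with values in [K[X]] *)

Section Symbol.
Variable K : comNzRingType.
Local Notation At := (algAt K).

Definition fmonom_symbol (m : {fmonom bool}) : {poly K} :=
  \prod_(i <- (m : seq bool)) (if i then 0 else 'X).

Lemma fmonom_symbol_mmorphism : mmorphism fmonom_symbol.
Proof.
by split=> [m n|]; rewrite /fmonom_symbol ?fmM ?big_cat // fm1 big_nil.
Qed.

HB.instance Definition _ :=
  isMultiplicative.Build {fmonom bool} {poly K} fmonom_symbol
    fmonom_symbol_mmorphism.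

Definition free_symbol (x : free2 K) : {poly K} :=
  mmap (polyC : K -> {poly K}) fmonom_symbol (x : {malg K[{fmonom bool}]}).

Lemma free_symbolB : {morph free_symbol : x y / x - y}.
Proof. exact: mmapB. Qed.
Lemma free_symbolD : {morph free_symbol : x y / x + y}.
Proof. exact: mmapD. Qed.
Lemma free_symbolM : {morph free_symbol : x y / x * y}.
Proof.
have [symM _] :=
  @mmap_is_multiplicative {fmonom bool} K {poly K} polyC fmonom_symbol.
by move=> x y; apply: (symM x y).
Qed.
Lemma free_symbol1 : free_symbol 1 = 1.
Proof. exact: mmap1. Qed.
Lemma free_symbolZ c x : free_symbol (c *: x) = c%:P * free_symbol x.
Proof. exact: mmapZ. Qed.
Lemma free_symbol_a : free_symbol (free_a K) = 'X.
Proof. by rewrite /free_symbol mmapU mul1r /fmonom_symbol fmU big_seq1. Qed.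
Lemma free_symbol_b : free_symbol (free_b K) = 0.
Proof. by rewrite /free_symbol mmapU mul1r /fmonom_symbol fmU big_seq1. Qed.
Lemma free_symbol0 : free_symbol 0 = 0.
Proof. exact: mmap0. Qed.

Lemma free_symbol_rel (x : free2 K) : x \in @rel_ideal K -> free_symbol x = 0.
Proof.
move=> /asboolP[s ->]; elim/big_rec: _ => [|u y _ IH]; first exact: free_symbol0.
rewrite free_symbolD IH !free_symbolM.
rewrite (jordan_rel_morph _ _ free_symbolB free_symbolM) /jordan_rel free_symbol_b.
by rewrite expr2 !(mulr0, mul0r, subr0, addr0).
Qed.

Lemma free_symbol_horner p : free_symbol (horner_alg (free_a K) p) = p.
Proof.
rewrite (morph_horner_alg _ _ free_symbolD free_symbolM) ?free_symbol_a.
  by elim/poly_ind: p => [|p c IH];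
    rewrite ?horner_alg0 // horner_algD horner_algM IH horner_algX horner_algC alg_polyC.
by move=> c; rewrite free_symbolZ free_symbol1 mulr1 alg_polyC.
Qed.

Lemma pi_algA_horner p :
  \pi_(algA K)%qT (horner_alg (free_a K) p) = horner_alg (gen_a K) p.
Proof.
apply: (morph_horner_alg (B := algA K)) => [x y|x y|c].
- exact: algquot_piD.
- exact: algquot_piM.
- exact: algquot_piZ.
Qed.

(** Far terms of the sequences satisfy the equation in [algA K] modulo [bideal 1]; lifted to the
    free algebra, the symbol sends the left side to [p] and multiples of [b] to 0. *)
Lemma horner_at_modb_inj p (y : At) : horner_alg (at_a K) p = at_b K * y -> p = 0.
Proof.
elim/algAtW: y => y.
rewrite -to_algAt_horner /at_b -algquot_piM => /algAt_eq /(_ 1%N)[N /(_ N (leqnn N))].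
rewrite cauchy_valM /= => /asboolP[z]; rewrite expr1 => /eqP.
rewrite subr_eq -mulrDr; elim/quotW: (z + _) => u; rewrite -pi_algA_horner => /eqP.
rewrite -[X in _ = X](algquot_piM _ (free_b K) u) => /algquot_eq /free_symbol_rel /eqP.
by rewrite free_symbolB free_symbolM free_symbol_b mul0r subr0 free_symbol_horner => /eqP.
Qed.

End Symbol.

(** * The action of a on E/bE *)

Section QuotientByMonic.
Variables (K : fieldType) (P : algAt K) (k : nat) (p0 : {poly K}).
Local Notation a := (at_a K).
Local Notation b := (at_b K).
Hypothesis P_lifts : lifts b a k p0 P.

Lemma at_ab_comm : a * b = b * (a + b).
Proof. by rewrite mulrDr -expr2 -at_ab addrC subrK. Qed.

(** This map plays the role of [theta], presenting [E/bE] as [K[X]/(p0)]. *)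
Definition quot_theta (p : {poly K}) : modE_b P :=
  \pi_(modE_b P)%qT (\pi_(modE P)%qT (horner_alg a p : (algAt K)^o) : modE_C P).

Lemma quot_theta_linear c p q :
  quot_theta (c *: p + q) = c *: quot_theta p + quot_theta q.
Proof.
rewrite /quot_theta horner_algD horner_algZ -(lquot_piP (bE_submod P)).
congr (\pi_(modE_b P)%qT _).
rewrite -mulr_algl -[c%:A * _]/(c%:A *: (horner_alg a p : (algAt K)^o)).
exact: (lquot_piP (left_ideal_submod P)).
Qed.

Lemma act_a_quot_theta p : act_a P (quot_theta p) = quot_theta ('X * p).
Proof.
rewrite /quot_theta act_a_pi horner_alg_mulX; congr (\pi_(modE_b P)%qT _).
exact: (lquot_piZ (left_ideal_submod P)).
Qed.

Lemma pi_modE_b_eq (x y : modE P) :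
  \pi_(modE_b P)%qT (x : modE_C P) = \pi_(modE_b P)%qT (y : modE_C P) <->
  exists z : modE P, x = b *: z + y.
Proof.
split=> [/(lquot_eq (bE_submod P))/asboolP[z xy]|[z xy]].
  by exists z; apply/eqP; rewrite -subr_eq; apply/eqP.
by apply/(lquot_eq (bE_submod P))/asboolP; exists z; rewrite xy; apply: addrK.
Qed.

Lemma pi_modE_eq (x y : algAt K) :
  \pi_(modE P)%qT (x : (algAt K)^o) = \pi_(modE P)%qT (y : (algAt K)^o) <->
  exists u, x - y = u * P.
Proof.
split; first by move/(lquot_eq (left_ideal_submod P)) => /asboolP.
by move=> xy; apply/(lquot_eq (left_ideal_submod P))/asboolP.
Qed.

Lemma quot_theta_surj x : exists p, x = quot_theta p.
Proof.
elim/quotW: x => x; elim/quotW: (x : modE P) => y.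
have [p [z ->]] := at_modb y; exists p; apply/pi_modE_b_eq.
exists (\pi_(modE P)%qT (z : (algAt K)^o)); rewrite addrC.
exact: (lquot_piP (left_ideal_submod P)).
Qed.

(** Writing [u] as [r] evaluated at [a] plus a multiple of [b], and moving [b] left across [r],
    shows that [u * P] reduces to [r * p0] modulo [b]; [horner_at_modb_inj] then compares
    polynomials. *)
Lemma quot_theta_eq0 p : quot_theta p = 0 <-> p0 %| p.
Proof.
have -> : 0 = quot_theta 0.
  by apply: (addrI (quot_theta 0)); rewrite addr0 -[X in X + _]scale1r
    -quot_theta_linear scale1r addr0.
have [m Mm PE] := P_lifts.
have aE q : exists y, horner_alg a q * b = b * y.
  by have [y _ ?] := horner_b at_ab_comm (leqnSn (size q)); eexists; eassumption.
split=> [/pi_modE_b_eq[z]|/dvdpP[q ->]]; last first.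
  have [y qb] := aE q; apply/pi_modE_b_eq.
  exists (\pi_(modE P)%qT (- (y * m) : (algAt K)^o)).
  rewrite -[RHS](lquot_piP (left_ideal_submod P)); apply/pi_modE_eq.
  exists (horner_alg a q).
  rewrite horner_alg0 addr0 horner_algM PE mulrDr (mulrA _ b) qb.
  by rewrite -[_ *: _]/(b * - (y * m)) mulrN opprK mulrA.
elim/quotW: z => z.
rewrite -[X in _ = X](lquot_piP (left_ideal_submod P)) => /pi_modE_eq[u].
have [r [u' ->]] := at_modb u; have [y rb] := aE r.
rewrite horner_alg0 addr0 -[_ *: _]/(b * z) => /eqP; rewrite subr_eq => /eqP pE.
apply/dvdpP; exists r; apply/eqP; rewrite -subr_eq0; apply/eqP.
apply: (@horner_at_modb_inj _ _ (y * m + u' * P + z)).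
rewrite horner_algB pE horner_algM mulrDl {1}PE mulrDr (mulrA _ b m) rb.
set t := horner_alg _ _ * horner_alg _ _; rewrite -!mulrA -!(addrA t) addrC.
by rewrite subrK !mulrDr.
Qed.

End QuotientByMonic.

(** * The factorization given by the spectrum of [a] on [E/bE] *)

Lemma spectral_factorization (K : closedFieldType) (k : nat) (P : algAt K)
    (P_monic : monic_in (at_a K) k P)
    (l : nat) (v : 'I_l -> K) (d : 'I_l -> nat)
    (v_distinct : injective v)
    (v_eigen : forall z : K,
       is_eigenvalue (act_a P) z <-> exists i : 'I_l, z = v i)
    (d_dim : forall i : 'I_l,
       has_dim (spectral_space (act_a P) (v i)) (d i)) :
  exists Q : 'I_l -> algAt K,
    (forall i : 'I_l, monic_in (at_a K - (v i)%:A) (d i) (Q i)) /\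
    P = \prod_(i < l) Q i.
Proof.
have ser_recl := @bseries_recl K.
have [c PE] := P_monic.
have [p0 [p0_monic sp0]] := monic_lifts (at_a K) ser_recl c.
rewrite -PE => lP.
have p0n := monic_neq0 p0_monic.
have th_lin := @quot_theta_linear _ P; have th_surj := @quot_theta_surj _ P.
have th_eq0 := quot_theta_eq0 lP; have T_th := @act_a_quot_theta _ P.
have [r p0E] := closed_field_poly_normal p0.
rewrite (monicP p0_monic) scale1r in p0E.
have rv z : z \in r -> exists i, z = v i.
  move=> zr; apply/v_eigen/(eigenvalue_root th_lin th_surj th_eq0 T_th z p0n).
  by rewrite p0E root_prod_XsubC.
rewrite (prod_XsubC_count v_distinct rv) in p0E.
set m := (fun i => count_mem (v i) r) in p0E.
(* The multiplicity of [v i] in [p0] and [d i] are dimensions of the same spectral subspace; the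
   cofactor [h] is the product over the other roots. *)
have md i : count_mem (v i) r = d i.
  apply: has_dim_uniq (d_dim i).
  have p0E' := p0E; rewrite (bigD1 i) //= in p0E'.
  apply: (has_dim_spectral th_lin th_surj th_eq0 T_th p0n p0E').
  rewrite -coprimep_XsubC; elim/big_ind: _ => [|p q cp cq|j ji].
  - exact: coprime1p.
  - by rewrite coprimepMl cp.
  - by apply/coprimep_expl/coprimep_XsubC2; rewrite subr_eq0 (inj_eq v_distinct) eq_sym.
have {}p0E : p0 = \prod_(i < l) ('X - (v i)%:P) ^+ d i.
  by rewrite p0E; apply: eq_bigr => i _; rewrite md.
have kE : k = (\sum_(i < l) d i)%N.
  by apply: succn_inj; rewrite -sp0 p0E size_prod_XsubC_exp.
rewrite p0E kE in lP.
have [Q [lQ QE]] :=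
  hensel_prod (@at_ab_comm K) (@at_separated K) ser_recl v_distinct lP.
exists Q; split=> [i|]; last exact: QE.
have u_monic : ('X - (v i)%:P) ^+ d i \is monic by exact/monic_exp/monicXsubC.
(* The factor, so far a lift expressed in [a], is expanded again in powers of [a - v i]. *)
have [e eE] := lifts_monic (@at_separated K) ser_recl (v i) u_monic (size_exp_XsubC _ _) (lQ i).
by exists e; rewrite eE.
Qed.

Theorem corollary3p1p3 (R : realType) (k : nat) (P : algAt R[i])
    (P_monic : monic_in (at_a R[i]) k P)
    (l : nat) (v : 'I_l -> R[i]) (d : 'I_l -> nat)
    (v_distinct : injective v)
    (v_eigen : forall z : R[i],
       is_eigenvalue (act_a P) z <-> exists i : 'I_l, z = v i)
    (d_dim : forall i : 'I_l,
       has_dim (spectral_space (act_a P) (v i)) (d i)) :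
  exists Q : 'I_l -> algAt R[i],
    (forall i : 'I_l, monic_in (at_a R[i] - (v i)%:A) (d i) (Q i)) /\
    P = \prod_(i < l) Q i.
Proof.
exact: (spectral_factorization P_monic v_distinct v_eigen d_dim).
Qed.
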